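(* Let $A$ be a four-dimensional absolute-valued algebra with a left unit satisfying $(x^2,x^2,x^2)=0$ for all $x\in A$. Then $A$ is isomorphic to one of $\mathbb{H}$, ${}^*\mathbb{H}$, ${}^*\mathbb{H}(i,1)$. Among these, ${}^*\mathbb{H}(i,1)$ has degree $4$ and the other two have degree $2$.
   Context: An absolute-valued algebra is a nonzero real algebra with a norm satisfying $\|xy\|=\|x\|\|y\|$. $(x,y,z)=(xy)z-x(yz)$. ${}^*\mathbb{H}$ is the normed space $\mathbb{H}$ with product $x\odot y=\bar x y$, and ${}^*\mathbb{H}(i,1)$ is $\mathbb{H}$ with product $x\odot y=\bar x\, i\, y$, where $\bar x$ is quaternion conjugation. The degree of a finite-dimensional algebra is the smallest $n$ such that every single-generated subalgebra has dimension $\le n$. *)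

(* Defs.v *)
From HB Require Import structures.
From mathcomp Require Import all_boot all_order all_algebra.
From mathcomp Require Import reals.
Set Implicit Arguments. Unset Strict Implicit. Unset Printing Implicit Defensive.
Import Order.TTheory GRing.Theory Num.Theory.
Local Open Scope ring_scope.

Section Defs.
Variable R : realType.

Definition bilinear_prod (V : vectType R) (mul : V -> V -> V) : Prop :=
  (forall (a : R) (x y z : V), mul (a *: x + y) z = a *: mul x z + mul y z) /\
  (forall (a : R) (x y z : V), mul z (a *: x + y) = a *: mul z x + mul z y).

Definition is_norm (V : vectType R) (nrm : V -> R) : Prop :=
  (forall x, nrm x = 0 <-> x = 0) /\
  (forall (a : R) x, nrm (a *: x) = `|a| * nrm x) /\
  (forall x y, nrm (x + y) <= nrm x + nrm y).

Definition absolute_valued (V : vectType R) (mul : V -> V -> V) (nrm : V -> R) : Prop :=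
  (exists x : V, x != 0) /\ bilinear_prod mul /\ is_norm nrm /\
  (forall x y, nrm (mul x y) = nrm x * nrm y).

Definition has_left_unit (V : vectType R) (mul : V -> V -> V) : Prop :=
  exists e : V, forall x, mul e x = x.

Definition associator (V : vectType R) (mul : V -> V -> V) (x y z : V) : V :=
  mul (mul x y) z - mul x (mul y z).

Definition alg_isomorphic (V W : vectType R) (mulV : V -> V -> V) (mulW : W -> W -> W) : Prop :=
  exists f : V -> W,
    (forall (a : R) x y, f (a *: x + y) = a *: f x + f y) /\ bijective f /\
    (forall x y, f (mulV x y) = mulW (f x) (f y)).

Definition subalg_closed (V : vectType R) (mul : V -> V -> V) (U : {vspace V}) : Prop :=
  forall u v, u \in U -> v \in U -> mul u v \in U.

Definition generated_subalg (V : vectType R) (mul : V -> V -> V) (x : V) (U : {vspace V}) : Prop :=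
  x \in U /\ subalg_closed mul U /\
  (forall W : {vspace V}, x \in W -> subalg_closed mul W -> (U <= W)%VS).

Definition gen_dims_le (V : vectType R) (mul : V -> V -> V) (n : nat) : Prop :=
  forall (x : V) (U : {vspace V}), generated_subalg mul x U -> (\dim U <= n)%N.

Definition algebra_degree (V : vectType R) (mul : V -> V -> V) (n : nat) : Prop :=
  gen_dims_le mul n /\ (forall m, gen_dims_le mul m -> (n <= m)%N).

(** ** Quaternions, realised on R^4 with basis 1, i, j, k *)
Definition quat := 'rV[R]_4.
Definition qc (q : quat) (k : nat) : R := q 0 (inord k).
Definition qmk (a b c d : R) : quat := \row_(i < 4) [:: a; b; c; d]`_i.

Definition qmul (p q : quat) : quat :=
  qmk (qc p 0 * qc q 0 - qc p 1 * qc q 1 - qc p 2 * qc q 2 - qc p 3 * qc q 3)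
      (qc p 0 * qc q 1 + qc p 1 * qc q 0 + qc p 2 * qc q 3 - qc p 3 * qc q 2)
      (qc p 0 * qc q 2 - qc p 1 * qc q 3 + qc p 2 * qc q 0 + qc p 3 * qc q 1)
      (qc p 0 * qc q 3 + qc p 1 * qc q 2 - qc p 2 * qc q 1 + qc p 3 * qc q 0).

Definition qconj (q : quat) : quat := qmk (qc q 0) (- qc q 1) (- qc q 2) (- qc q 3).
Definition qi : quat := qmk 0 1 0 0.

Definition qstar_mul (p q : quat) : quat := qmul (qconj p) q.
Definition qstar_i1_mul (p q : quat) : quat := qmul (qmul (qconj p) qi) q.

End Defs.

(* Main.v *)
Require Import Defs.
From HB Require Import structures.
From mathcomp Require Import all_boot all_order all_algebra.
From mathcomp Require Import reals.
From mathcomp Require Import complex ring lra.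
Set Implicit Arguments.
Unset Strict Implicit.
Import Order.TTheory GRing.Theory Num.Theory.
Local Open Scope ring_scope.

(** A complex eigenvalue of left multiplication by z yields a plane on which
    s e + t z acts as a complex number mu; the norm being multiplicative, its
    restriction to that plane scales by |mu|, so N (s e + t z) = |mu|.  Right
    multiplications being bijective, N is Euclidean on every plane, hence comes
    from an inner product.  With T x = x e, the linear term of the condition at
    x = e + t u gives T^2 = 1, and (T x) y is a unital composition product.  An
    orthonormal pair of eigenvectors i, j of T in e^perp spans with (T i) j a
    quaternion basis diagonalising T, so the product of A is phi(x) y on the
    quaternions, with phi a diagonal matrix of signs fixing 1.  Two minus signs
    contradict the condition at i + j; none, three, and one give the three
    algebras. *)

(** * Quaternion coordinates and the degrees of the three model algebras *)

Section Quaternions.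
Variable R : realType.
Implicit Types p q : quat R.

Lemma qc_mk (a b c d : R) :
  (qc (qmk a b c d) 0 = a) * (qc (qmk a b c d) 1 = b) *
  (qc (qmk a b c d) 2 = c) * (qc (qmk a b c d) 3 = d).
Proof. by rewrite /qc /qmk !mxE !inordK. Qed.

Lemma qcD p q k : qc (p + q) k = qc p k + qc q k.
Proof. by rewrite /qc mxE. Qed.

Lemma qcZ (a : R) p k : qc (a *: p) k = a * qc p k.
Proof. by rewrite /qc mxE. Qed.

Lemma qcN p k : qc (- p) k = - qc p k.
Proof. by rewrite /qc mxE. Qed.

Lemma quatP p q :
  qc p 0 = qc q 0 -> qc p 1 = qc q 1 -> qc p 2 = qc q 2 -> qc p 3 = qc q 3 ->
  p = q.
Proof.
move=> h0 h1 h2 h3; apply/rowP => i; rewrite -(inord_val i).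
by case: i => [[|[|[|[|//]]]] ?] /=.
Qed.

Lemma qc0 k : qc (0 : quat R) k = 0.
Proof. by rewrite /qc mxE. Qed.

Definition qcE := (qc_mk, qcD, qcZ, qcN, qc0).

Lemma quat_coordE p :
  p = qc p 0 *: qmk 1 0 0 0 + qc p 1 *: qmk 0 1 0 0
    + qc p 2 *: qmk 0 0 1 0 + qc p 3 *: qmk 0 0 0 1.
Proof. by apply: quatP; rewrite !qcE; ring. Qed.

Lemma gen_dims_le_full (mul : quat R -> quat R -> quat R) : gen_dims_le mul 4.
Proof.
move=> x U _; by rewrite (leq_trans (dimvS (subvf U))) // dimvf dim_matrix.
Qed.

Definition qplane p : {vspace quat R} := (<[qmk 1 0 0 0]> + <[p]>)%VS.

Lemma qplaneP p q :
  reflect (exists s t, q = s *: qmk 1 0 0 0 + t *: p) (q \in qplane p).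
Proof.
apply: (iffP memv_addP).
  by case=> _ /vlineP [s ->] [_ /vlineP [t ->] ->]; exists s, t.
by case=> s [t ->]; exists (s *: qmk 1 0 0 0);
  [|exists (t *: p)]; rewrite ?memvZ ?memv_line.
Qed.

Lemma dim_qplane_le p : (\dim (qplane p) <= 2)%N.
Proof.
apply: leq_trans (dimv_add_leqif _ _) _.
by rewrite !dim_vline; case: (_ != 0); case: (_ != 0).
Qed.

Lemma dim_qplane_qi : \dim (qplane (qi R)) = 2%N.
Proof.
rewrite dimv_disjoint_sum; last first.
  apply/eqP; rewrite -subv0; apply/subvP => q.
  rewrite memv_cap memv0 => /andP [/vlineP [s ->] /vlineP [t h]].
  move: (congr1 (fun r : quat R => qc r 0) h) => /=.
  by rewrite !qcE mulr1 mulr0 => ->; rewrite scale0r.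
rewrite !dim_vline.
have ->: (qmk 1 0 0 0 : quat R) != 0.
  apply/eqP => /(congr1 (fun r : quat R => qc r 0)) /=.
  by rewrite !qcE => /eqP; rewrite oner_eq0.
have -> // : qi R != 0.
apply/eqP => /(congr1 (fun r : quat R => qc r 1)) /=.
by rewrite !qcE => /eqP; rewrite oner_eq0.
Qed.

(** Each [x] lies in the closed plane spanned by [1] and [x], which bounds the degree by 2. The
    bound is attained at [i]: its square is a nonzero multiple of [1], so a subalgebra containing
    [i] contains the whole plane of [1] and [i]. *)
Lemma degree_qplane (mul : quat R -> quat R -> quat R) :
  (forall p, Defs.subalg_closed mul (qplane p)) ->
  mul (qi R) (qi R) \in <[qmk 1 0 0 0]>%VS -> mul (qi R) (qi R) != 0 ->
  algebra_degree mul 2.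
Proof.
move=> closed ii1 ii0; split=> [x U [_ [_ /(_ (qplane x)) Umin]]|m le_m].
  apply: leq_trans (dimvS (Umin _ (closed x))) (dim_qplane_le x).
  by apply/qplaneP; exists 0, 1; rewrite scale0r add0r scale1r.
rewrite -dim_qplane_qi; apply: (le_m (qi R)); split; [|split].
- by apply/qplaneP; exists 0, 1; rewrite scale0r add0r scale1r.
- exact: closed.
move=> W iW closedW; rewrite subv_add -!memvE iW andbT.
case/vlineP: ii1 ii0 (closedW _ _ iW iW) => s ->.
rewrite scaler_eq0 negb_or => /andP [s0 _].
by move/(memvZ s^-1); rewrite scalerA mulVf // scale1r.
Qed.

Lemma degree_qmul : algebra_degree (@qmul R) 2.
Proof.
apply: degree_qplane.
- move=> p _ _ /qplaneP [s [t ->]] /qplaneP [s' [t' ->]]; apply/qplaneP.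
  (* The coefficients come from [p^2 = 2 Re(p) p - |p|^2]. *)
  exists (s * s' - t * t' * (qc p 0 ^+ 2 + qc p 1 ^+ 2 + qc p 2 ^+ 2
    + qc p 3 ^+ 2)), (s * t' + s' * t + 2 * t * t' * qc p 0).
  by apply: quatP; rewrite !qcE; ring.
- apply/vlineP; exists (-1); apply: quatP; rewrite !qcE; ring.
apply/eqP => /(congr1 (fun r : quat R => qc r 0)) /=.
rewrite !qcE; lra.
Qed.

Lemma degree_qstar_mul : algebra_degree (@qstar_mul R) 2.
Proof.
apply: degree_qplane.
- move=> p _ _ /qplaneP [s [t ->]] /qplaneP [s' [t' ->]]; apply/qplaneP.
  (* Here [conj p = 2 Re(p) - p] and [conj p * p = |p|^2]. *)
  exists (s * s' + 2 * qc p 0 * t * s' + t * t' * (qc p 0 ^+ 2 + qc p 1 ^+ 2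
    + qc p 2 ^+ 2 + qc p 3 ^+ 2)), (s * t' - s' * t).
  by apply: quatP; rewrite !qcE; ring.
- apply/vlineP; exists 1; apply: quatP; rewrite !qcE; ring.
apply/eqP => /(congr1 (fun r : quat R => qc r 0)) /=.
rewrite !qcE; lra.
Qed.

Lemma degree_qstar_i1_mul : algebra_degree (@qstar_i1_mul R) 4.
Proof.
split=> [|m le_m]; first exact: gen_dims_le_full.
have <- : \dim (fullv : {vspace quat R}) = 4%N.
  by rewrite dimvf dim_matrix.
(* The element [x = 1 + j] generates everything: [x x = 2k], [k x = 1 - j], the sum of [x] and
   [1 - j] is [2], then [j = x - 1], and finally [1 1 = i] in this product. *)
apply: (le_m (qmk 1 0 1 0)); split; [exact: memvf | split=> [? ? _ _|W xW closed]; first exact: memvf].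
have kW : qmk 0 0 0 1 \in W.
  have := memvZ 2^-1 (closed _ _ xW xW); congr (_ \in W).
  by apply: quatP; rewrite !qcE; field.
have yW := closed _ _ kW xW.
have oW : qmk 1 0 0 0 \in W.
  have := memvZ 2^-1 (memvD xW yW); congr (_ \in W).
  by apply: quatP; rewrite !qcE; field.
have jW : qmk 0 0 1 0 \in W.
  have := memvB xW oW; congr (_ \in W).
  by apply: quatP; rewrite !qcE; ring.
have iW : qmk 0 1 0 0 \in W.
  have := closed _ _ oW oW; congr (_ \in W).
  by apply: quatP; rewrite !qcE; ring.
by apply/subvP => q _; rewrite (quat_coordE q) !memvD ?memvZ.
Qed.

End Quaternions.

Import VectorInternalTheory.

(** * Coordinates in an abstract vector space *)

Section CoordinateMorphism.
Variables (R : nzRingType) (V : vectType R).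
Implicit Types x y : V.

Lemma v2rD x y : v2r (x + y) = v2r x + v2r y. Proof. exact: linearD. Qed.
Lemma v2rN x : v2r (- x) = - v2r x. Proof. exact: linearN. Qed.
Lemma v2rZ a x : v2r (a *: x) = a *: v2r x. Proof. exact: linearZ. Qed.
Lemma v2r0 : v2r (0 : V) = 0. Proof. exact: linear0. Qed.

End CoordinateMorphism.

Definition v2rE := (v2rD, v2rN, v2rZ, v2r0).

(* Reduces an identity between linear combinations of vectors to coordinates. *)
Ltac vcoord := apply: v2r_inj; rewrite ?v2rE; apply/rowP => ?; rewrite !mxE.
Ltac vring := vcoord; ring.

(** * Injectivity, kernels and complex eigenvalues of linear maps *)

Section LinearMaps.
Variables (R : rcfType) (V : vectType R).

Lemma linear_inj_bij (W : vectType R) (f : V -> W) :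
  (forall a x y, f (a *: x + y) = a *: f x + f y) ->
  (forall x, f x = 0 -> x = 0) -> \dim {:V} = \dim {:W} ->
  exists2 g, cancel f g & cancel g f.
Proof.
move=> lin_f f_inj dimVW.
pose F : {linear V -> W} := HB.pack f (GRing.isLinear.Build R V W *:%R f lin_f).
have FE x : linfun F x = f x by rewrite lfunE.
have kF : lker (linfun F) == 0%VS.
  rewrite -subv0; apply/subvP => x.
  by rewrite memv_ker FE memv0 => /eqP/f_inj ->.
have imF : limg (linfun F) = fullv.
  by apply/eqP; rewrite eqEdim subvf -dimVW limg_dim_eq ?(eqP kF) ?capv0 ?leqnn.
exists ((linfun F)^-1)%VF => x.
  by rewrite -FE lker0_lfunK.
by rewrite -FE limg_lfunVK // imF memvf.
Qed.

Lemma linear_nontrivial_ker (W : vectType R) (f : V -> W) :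
  (forall a x y, f (a *: x + y) = a *: f x + f y) ->
  (\dim {:W} < \dim {:V})%N -> exists2 x, x != 0 & f x = 0.
Proof.
move=> lin_f dimWV.
pose F : {linear V -> W} := HB.pack f (GRing.isLinear.Build R V W *:%R f lin_f).
have := limg_ker_dim (linfun F) fullv.
rewrite capfv => e.
have kF : lker (linfun F) != 0%VS.
  apply: contraTneq dimWV => k0; rewrite -leqNgt -e k0 dimv0 add0n.
  exact: dimvS (subvf _).
exists (vpick (lker (linfun F))); first by rewrite vpick0.
by have := memv_pick (lker (linfun F)); rewrite memv_ker lfunE => /eqP.
Qed.

(* A complex eigenvector x + iy for a + ib gives two real vectors killed by
   (f - a)^2 + b^2, at least one of which is nonzero. *)
Lemma linear_quadratic_eigen (f : V -> V) :
  (forall a x y, f (a *: x + y) = a *: f x + f y) -> (0 < dim V)%N ->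
  exists a b u, u != 0 /\ f (f u) = (2 * a) *: f u - (a ^+ 2 + b ^+ 2) *: u.
Proof.
move=> lin_f dimV.
pose F : {linear V -> V} := HB.pack f (GRing.isLinear.Build R V V *:%R f lin_f).
pose M := lin1_mx (v2r \o F \o r2v).
have ME u : v2r (f u) = v2r u *m M.
  by rewrite /M mul_rV_lin1 /= v2rK.
pose MC : 'M[R[i]]_(dim V) := map_mx (real_complex R) M.
have /closed_rootP [l] : size (char_poly MC) != 1%N.
  by rewrite size_char_poly eqSS -lt0n.
rewrite -eigenvalue_root_char => /eigenvalueP [v vM v0].
have ReD (c d : R[i]) : complex.Re (c + d) = complex.Re c + complex.Re d.
  by case: c d => ? ? [].
have Re_sum := big_morph (@complex.Re R) ReD erefl.
have ImD (c d : R[i]) : complex.Im (c + d) = complex.Im c + complex.Im d.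
  by case: c d => ? ? [].
have Im_sum := big_morph (@complex.Im R) ImD erefl.
pose x := r2v (map_mx (@complex.Re R) v).
pose y := r2v (map_mx (@complex.Im R) v).
have fx : f x = complex.Re l *: x - complex.Im l *: y.
  apply: v2r_inj; rewrite ME linearB !linearZ /= !r2vK; apply/rowP => j.
  move/rowP/(_ j): vM; rewrite !mxE => /(congr1 (@complex.Re R)).
  rewrite Re_sum => e; transitivity (complex.Re (l * v 0 j)).
    by rewrite -e; apply: eq_bigr => k _; rewrite !mxE; case: (v 0 k) => c d /=; ring.
  by case: (l) => c d; case: (v 0 j) => [c' d'] /=; ring.
have fy : f y = complex.Im l *: x + complex.Re l *: y.
  apply: v2r_inj; rewrite ME linearD !linearZ /= !r2vK; apply/rowP => j.
  move/rowP/(_ j): vM; rewrite !mxE => /(congr1 (@complex.Im R)).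
  rewrite Im_sum => e; transitivity (complex.Im (l * v 0 j)).
    by rewrite -e; apply: eq_bigr => k _; rewrite !mxE; case: (v 0 k) => c d /=; ring.
  by case: (l) => c d; case: (v 0 j) => [c' d'] /=; ring.
exists (complex.Re l), (complex.Im l).
have fD a u w : f (a *: u + w) = a *: f u + f w := lin_f a u w.
have f0 : f 0 = 0 by rewrite -[f]/(F : V -> V) linear0.
have fZ a u : f (a *: u) = a *: f u by rewrite -[f]/(F : V -> V) linearZ.
case: (eqVneq x 0) => [x0|]; last first.
  exists x; split=> //; rewrite {1}fx -scaleNr fD fZ fx fy.
  by vring.
exists y; split.
  apply: contraNneq v0 => y0; apply/eqP/rowP => j.
  have /rowP/(_ j) := congr1 v2r x0; have /rowP/(_ j) := congr1 v2r y0.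
  rewrite !r2vK !linear0 !mxE; case: (v 0 j) => c d /= -> -> //.
rewrite {1}fy fD fZ fx fy.
by vring.
Qed.

End LinearMaps.

(** If [a > b > 0], Bernoulli's inequality makes [(a / b)^n] grow at least linearly in [n], so it
    passes any constant [C]. *)
Lemma ler_of_expr_bound (R : realType) (C a b : R) :
  0 <= b -> (forall n, a ^+ n <= C * b ^+ n) -> a <= b.
Proof.
move=> b0 le_ab; rewrite leNgt; apply/negP => lt_ba.
move: b0; rewrite le0r => /predU1P [b0|b0].
  by have := le_ab 1%N; rewrite b0 !expr1 mulr0; lra.
pose d := a / b - 1.
have d0 : 0 < d by rewrite subr_gt0 ltr_pdivlMr // mul1r.
have bern n : 1 + d *+ n <= (1 + d) ^+ n.
  elim: n => [|n IHn]; first by rewrite mulr0n addr0.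
  rewrite exprS mulrSr; have dn : 0 <= d *+ n by rewrite mulrn_wge0 // ltW.
  have := ler_wpM2l (ltW d0) IHn; have := mulr_ge0 (ltW d0) dn.
  by move: IHn; move: ((1 + d) ^+ n) (d *+ n) => X Y; lra.
have le_C n : (1 + d) ^+ n <= C.
  by rewrite addrC subrK expr_div_n ler_pdivrMr ?exprn_gt0.
have [n ltn] : exists n, C / d < n%:R.
  exists (Num.bound `|C / d|).
  exact: le_lt_trans (ler_norm _) (archi_boundP (normr_ge0 _)).
have := le_trans (bern n) (le_C n); rewrite -mulr_natl.
by move: ltn; rewrite ltr_pdivrMr //; lra.
Qed.

(** * Arithmetic of bilinear products *)

Section BilinearProducts.
Variables (R : realType) (A : vectType R) (mul : A -> A -> A).
Hypothesis bil : bilinear_prod mul.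

Lemma prodDl x y z : mul (x + y) z = mul x z + mul y z.
Proof. by case: bil => h _; have := h 1 x y z; rewrite !scale1r. Qed.

Lemma prodDr x y z : mul x (y + z) = mul x y + mul x z.
Proof. by case: bil => _ h; have := h 1 y z x; rewrite !scale1r. Qed.

Lemma prod0l y : mul 0 y = 0.
Proof. by apply: (addrI (mul 0 y)); rewrite -prodDl !addr0. Qed.

Lemma prod0r y : mul y 0 = 0.
Proof. by apply: (addrI (mul y 0)); rewrite -prodDr !addr0. Qed.

Lemma prodZl a x y : mul (a *: x) y = a *: mul x y.
Proof. by case: bil => h _; have := h a x 0 y; rewrite prod0l !addr0. Qed.

Lemma prodZr a x y : mul x (a *: y) = a *: mul x y.
Proof. by case: bil => _ h; have := h a y 0 x; rewrite prod0r !addr0. Qed.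

Lemma prodNl x y : mul (- x) y = - mul x y.
Proof. by rewrite -scaleN1r prodZl scaleN1r. Qed.

Lemma prodNr x y : mul x (- y) = - mul x y.
Proof. by rewrite -scaleN1r prodZr scaleN1r. Qed.

Definition prodE := (prodDl, prodDr, prodZl, prodZr, prodNl, prodNr).

End BilinearProducts.

(** * The norm of an absolute-valued algebra with left unit is Euclidean *)

Section AbsoluteValued.
Variables (R : realType) (A : vectType R) (mul : A -> A -> A) (N : A -> R).
Variable e : A.
Hypothesis nontrivialA : exists x : A, x != 0.
Hypothesis bil : bilinear_prod mul.
Hypothesis normN : is_norm N.
Hypothesis norm_mul : forall x y, N (mul x y) = N x * N y.
Hypothesis mul_e : forall x, mul e x = x.

Lemma norm_eq0 x : N x = 0 <-> x = 0.
Proof. by case: normN. Qed.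

Lemma normZ a x : N (a *: x) = `|a| * N x.
Proof. by case: normN => _ []. Qed.

Lemma normD x y : N (x + y) <= N x + N y.
Proof. by case: normN => _ []. Qed.

Lemma norm_ge0 x : 0 <= N x.
Proof.
have := normD x (- x); rewrite subrr (norm_eq0 0).2 // -scaleN1r normZ normrN1.
lra.
Qed.

Lemma norm_gt0 x : x != 0 -> 0 < N x.
Proof.
by rewrite lt0r norm_ge0 andbT; apply: contraNneq => /norm_eq0 ->.
Qed.

Lemma av_mul_eq0 x y : mul x y = 0 -> x = 0 \/ y = 0.
Proof.
move/norm_eq0; rewrite norm_mul => /eqP.
by rewrite mulf_eq0 => /orP [] /eqP/norm_eq0; [left|right].
Qed.

Lemma norm_e : N e = 1.
Proof.
case: nontrivialA => x x0; have e0 : e != 0.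
  by apply: contraNneq x0 => e0; rewrite -(mul_e x) e0 (prod0l bil).
have := norm_mul e e; rewrite mul_e -{1}(mul1r (N e)).
by move/(mulIf (lt0r_neq0 (norm_gt0 e0))).
Qed.

Lemma norm_iter z u n : N (iter n (mul z) u) = N z ^+ n * N u.
Proof.
elim: n => [|n IHn]; first by rewrite expr0 mul1r.
by rewrite iterS norm_mul IHn exprS mulrA.
Qed.

(** On the span of [u] and [w u], left multiplication by [z = s e + t w] acts as the complex number
    [s + i t]. Hence the iterates [z^n u] grow at most like [|s + i t|^n] up to a constant, while
    multiplicativity makes their norm exactly [N z ^ n * N u]. *)
Lemma sq_norm_complex_le w u s t : u != 0 -> mul w (mul w u) = - u ->
  N (s *: e + t *: w) ^+ 2 <= s ^+ 2 + t ^+ 2.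
Proof.
move=> u0 wwu; set z := s *: e + t *: w.
have zE c d : mul z (c *: u + d *: mul w u)
    = (s * c - t * d) *: u + (s * d + t * c) *: mul w u.
  by rewrite /z !(prodE bil) !mul_e wwu; vring.
have iterE n : exists c d, iter n (mul z) u = c *: u + d *: mul w u /\
    c ^+ 2 + d ^+ 2 = (s ^+ 2 + t ^+ 2) ^+ n.
  elim: n => [|n [c [d [IHn IHcd]]]].
    by exists 1, 0; split; [vring|rewrite expr0; ring].
  exists (s * c - t * d), (s * d + t * c); split; first by rewrite iterS IHn.
  by rewrite (exprS (s ^+ 2 + _)) -IHcd; ring.
(* The constant comes from [|c| + |d| N w <= (1 + N w) sqrt (c^2 + d^2)], squared. *)
apply: (@ler_of_expr_bound _ ((1 + N w) ^+ 2)) => [|n].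
  by rewrite addr_ge0 ?sqr_ge0.
have [c [d [nE <-]]] := iterE n.
have le_z : N z ^+ n <= `|c| + `|d| * N w.
  rewrite -(ler_pM2r (norm_gt0 u0)) -norm_iter nE (le_trans (normD _ _)) //.
  by rewrite !normZ norm_mul mulrDl mulrA.
have W0 := norm_ge0 w.
rewrite exprAC (le_trans (ler_pM _ _ le_z le_z)) ?exprn_ge0 ?norm_ge0 //.
rewrite -(real_normK (num_real c)) -(real_normK (num_real d)).
have := normr_ge0 c; have := normr_ge0 d.
move: `|c| `|d| => x y y0 x0.
have := mulr_ge0 W0 (sqr_ge0 (x - y)); have := sqr_ge0 y.
have := mulr_ge0 W0 (mulr_ge0 x0 y0).
have := sqr_ge0 (N w * x).
by lra.
Qed.

(** Multiplying by [s e + t w] and by its conjugate [s e - t w] scales [u] by [s^2 + t^2], so the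
    two norms have this product. Neither squared norm exceeds [s^2 + t^2], which forces equality in
    both. *)
Lemma sq_norm_complex w u s t : u != 0 -> mul w (mul w u) = - u ->
  N (s *: e + t *: w) ^+ 2 = s ^+ 2 + t ^+ 2.
Proof.
move=> u0 wwu; have u_gt0 := norm_gt0 u0.
have le1 := sq_norm_complex_le s t u0 wwu.
have le2 := sq_norm_complex_le s (- t) u0 wwu.
have := norm_mul (s *: e + t *: w) (mul (s *: e + (- t) *: w) u).
have -> : mul (s *: e + t *: w) (mul (s *: e + - t *: w) u)
    = (s ^+ 2 + t ^+ 2) *: u.
  by rewrite !(prodE bil) !mul_e wwu; vring.
rewrite normZ norm_mul mulrA => /(mulIf (lt0r_neq0 u_gt0)).
rewrite ger0_norm ?addr_ge0 ?sqr_ge0 //.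
move: le1 le2 (norm_ge0 (s *: e + t *: w)) (norm_ge0 (s *: e + - t *: w)).
rewrite sqrrN; set r := s ^+ 2 + t ^+ 2.
move: (N _) (N _) => b a a2 b2 a0 b0 rE.
apply/eqP; rewrite eq_le a2 /=.
case: (ltrP 0 r) => [r0|]; last by move/le_trans; apply; exact: sqr_ge0.
have rr : r * r = a ^+ 2 * b ^+ 2 by rewrite rE; ring.
by rewrite -(ler_pM2r r0) rr; exact: ler_wpM2l (sqr_ge0 a) _ _ b2.
Qed.

Lemma sq_norm_span_e z : exists a b, forall s t,
  N (s *: e + t *: z) ^+ 2 = (s + t * a) ^+ 2 + (t * b) ^+ 2.
Proof.
have dimA : (0 < dim A)%N.
  case: nontrivialA => x x0; rewrite -dimvf lt0n dimv_eq0.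
  by apply: contraNneq x0 => A0; rewrite -memv0 -A0 memvf.
have lin_z c x y : mul z (c *: x + y) = c *: mul z x + mul z y.
  by rewrite !(prodE bil).
have [a [b [u [u0 zzu]]]] := linear_quadratic_eigen lin_z dimA.
(* With eigenvalue [a + i b], the element [z - a e] satisfies [w (w u) = - b^2 u]. If [b = 0], the
   absence of zero divisors gives [z = a e]; otherwise dividing by [b] reduces to the complex
   case. *)
exists a, b => s t; case: (eqVneq b 0) => [b0|b0].
  have zz0 : mul (z - a *: e) (mul (z - a *: e) u) = 0.
    by rewrite !(prodE bil) !mul_e zzu b0; vring.
  have -> : z = a *: e.
    apply/eqP; rewrite -subr_eq0; apply/eqP.
    by case: (av_mul_eq0 zz0) => // /av_mul_eq0 [] // /eqP; rewrite (negPf u0).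
  rewrite scalerA -scalerDl normZ norm_e mulr1 real_normK ?num_real //.
  by rewrite b0; ring.
have w_u : mul (b^-1 *: (z - a *: e)) (mul (b^-1 *: (z - a *: e)) u) = - u.
  rewrite !(prodE bil) !mul_e zzu.
  by vcoord; field.
rewrite -(sq_norm_complex _ _ u0 w_u); congr (N _ ^+ 2).
by vcoord; field.
Qed.

Lemma mul_right_surj y x : y != 0 -> exists z, mul z y = x.
Proof.
move=> y0; have [||//|g _ gK] := @linear_inj_bij R A A (mul^~ y).
- by move=> a u v; rewrite !(prodE bil).
- by move=> z /av_mul_eq0 [] // /eqP; rewrite (negPf y0).
by exists (g x); rewrite gK.
Qed.

(** Writing [x = z y] turns [s x + t y] into [(t e + s z) y], so the quadratic form known on the
    span of [e] and [z] carries over, scaled by [N y ^ 2]. *)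
Lemma sq_norm_span x y : exists c, forall s t,
  N (s *: x + t *: y) ^+ 2 = s ^+ 2 * N x ^+ 2 + 2 * s * t * c + t ^+ 2 * N y ^+ 2.
Proof.
case: (eqVneq y 0) => [->|y0].
  exists 0 => s t; rewrite scaler0 addr0 normZ (norm_eq0 0).2 //.
  by rewrite exprMn real_normK ?num_real //; ring.
have [z <-] := mul_right_surj x y0; have [a [b zE]] := sq_norm_span_e z.
exists (a * N y ^+ 2) => s t; rewrite norm_mul.
have -> : s *: mul z y + t *: y = mul (t *: e + s *: z) y.
  by rewrite !(prodE bil) mul_e addrC.
have := zE 0 1; rewrite scale0r add0r scale1r norm_mul !exprMn zE => ->.
by ring.
Qed.

Definition dot x y := (N (x + y) ^+ 2 - N (x - y) ^+ 2) / 4.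

Lemma sq_normD s t x y :
  N (s *: x + t *: y) ^+ 2
    = s ^+ 2 * N x ^+ 2 + 2 * s * t * dot x y + t ^+ 2 * N y ^+ 2.
Proof.
have [c cE] := sq_norm_span x y; rewrite cE /dot.
have := cE 1 1; have := cE 1 (-1); rewrite !scale1r scaleN1r => -> ->.
by field.
Qed.

Lemma dotC x y : dot x y = dot y x.
Proof.
rewrite /dot [y + x]addrC -[y - x]opprB -(scaleN1r (x - y)) normZ normrN1.
by rewrite mul1r.
Qed.

Lemma dot_self x : dot x x = N x ^+ 2.
Proof.
rewrite /dot subrr (norm_eq0 0).2 // -[x in x + x]scale1r -scalerDl normZ.
by rewrite ger0_norm ?addr_ge0 ?ler01 //; field.
Qed.

Lemma dotZl a x y : dot (a *: x) y = a * dot x y.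
Proof.
have := sq_normD 1 1 (a *: x) y; rewrite !scale1r -{1}(scale1r y) sq_normD.
rewrite normZ exprMn real_normK ?num_real //; lra.
Qed.

(** The Jordan-von Neumann argument: the parallelogram law at [x + z, y + z] and at [x - z, y - z],
    subtracted, gives additivity up to a factor 2 that homogeneity removes. *)
Lemma dotDl x y z : dot (x + y) z = dot x z + dot y z.
Proof.
have pl u v : N (u + v) ^+ 2 + N (u - v) ^+ 2 = 2 * N u ^+ 2 + 2 * N v ^+ 2.
  have := sq_normD 1 1 u v; have := sq_normD 1 (-1) u v.
  by rewrite !scale1r scaleN1r => -> ->; ring.
have := dotZl 2 z (x + y); rewrite ![dot _ (x + y)]dotC.
have := pl (x + z) (y + z); have := pl (x - z) (y - z).
have -> : x - z + (y - z) = x + y - 2 *: z by vring.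
have -> : x - z - (y - z) = x - y by vring.
have -> : x + z + (y + z) = x + y + 2 *: z by vring.
have -> : x + z - (y + z) = x - y by vring.
by rewrite /dot; lra.
Qed.

End AbsoluteValued.

(** The odd part [t c1 + t^3 c3 + t^5 c5] vanishes at 1, 2 and 3, and the resulting Vandermonde-type
    system is invertible. *)
Lemma linear_coef_eq0 (R : realType) (c1 c2 c3 c4 c5 c6 : R) :
  (forall t, t * c1 + t ^+ 2 * c2 + t ^+ 3 * c3 + t ^+ 4 * c4
    + t ^+ 5 * c5 + t ^+ 6 * c6 = 0) -> c1 = 0.
Proof.
by move=> c0; move: (c0 1) (c0 (-1)) (c0 2) (c0 (-2)) (c0 3) (c0 (-3)); lra.
Qed.

(** * Composition products and quaternion multiplication tables *)

Section Composition.
Variables (R : realType) (A : vectType R) (mul : A -> A -> A) (B : A -> A -> R).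
Variable e : A.
Hypothesis bil : bilinear_prod mul.
Hypothesis mul_e : forall x, mul e x = x.
Hypothesis BC : forall x y, B x y = B y x.
Hypothesis BDl : forall x y z, B (x + y) z = B x z + B y z.
Hypothesis BZl : forall a x y, B (a *: x) y = a * B x y.
Hypothesis B_gt0 : forall x, x != 0 -> 0 < B x x.
Hypothesis B_mul : forall x y, B (mul x y) (mul x y) = B x x * B y y.

Lemma form0l y : B 0 y = 0.
Proof. by rewrite -(scale0r 0) BZl mul0r. Qed.

Lemma formDr x y z : B x (y + z) = B x y + B x z.
Proof. by rewrite BC BDl ![B _ x]BC. Qed.

Lemma formZr a x y : B x (a *: y) = a * B x y.
Proof. by rewrite BC BZl BC. Qed.

Lemma formNl x y : B (- x) y = - B x y.
Proof. by rewrite -scaleN1r BZl mulN1r. Qed.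

Lemma formNr x y : B x (- y) = - B x y.
Proof. by rewrite BC formNl BC. Qed.

Definition formE := (BDl, BZl, formDr, formZr, formNl, formNr).

Lemma form_nondeg x : (forall y, B x y = 0) -> x = 0.
Proof.
move=> x0; apply/eqP/negPn/negP => /B_gt0; rewrite x0 ltxx //.
Qed.

Lemma form_mul_l x y z : B (mul x y) (mul x z) = B x x * B y z.
Proof.
have := B_mul x (y + z); have := B_mul x y; have := B_mul x z.
rewrite !(prodE bil) !formE [B (mul x z) (mul x y)]BC [B z y]BC; lra.
Qed.

Lemma form_mul_r x y z : B (mul x z) (mul y z) = B x y * B z z.
Proof.
have := B_mul (x + y) z; have := B_mul x z; have := B_mul y z.
rewrite !(prodE bil) !formE [B (mul y z) (mul x z)]BC [B y x]BC; lra.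
Qed.

Lemma form_mul_exchange x y z w :
  B (mul x y) (mul z w) + B (mul x w) (mul z y) = 2 * B x z * B y w.
Proof.
have := form_mul_r x z (y + w); have := form_mul_r x z y.
have := form_mul_r x z w.
by rewrite !(prodE bil) !formE [B w y]BC; lra.
Qed.

Section UnitalQuaternions.
Hypothesis mul_r_e : forall x, mul x e = x.
Hypothesis B_e : B e e = 1.

(** The exchange identity with [e] makes left multiplication by an imaginary [x] skew-adjoint, and
    by [form_mul_l] it scales the form by [B x x]; nondegeneracy concludes. *)
Lemma imag_mulK x y : B x e = 0 -> mul x (mul x y) = - B x x *: y.
Proof.
move=> xe; apply/eqP; rewrite -subr_eq0; apply/eqP/form_nondeg => z.
have := form_mul_exchange x (mul x y) e z; rewrite !mul_e form_mul_l xe !formE.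
by rewrite [B z y]BC; lra.
Qed.

Lemma mul_imagK x y : B x e = 0 -> mul (mul y x) x = - B x x *: y.
Proof.
move=> xe; apply/eqP; rewrite -subr_eq0; apply/eqP/form_nondeg => z.
have := form_mul_exchange (mul y x) x z e; rewrite !mul_r_e form_mul_r xe !formE.
by lra.
Qed.

(** Linearise the identity [x^2 = - B x x e] at [x + y]. *)
Lemma imag_mulC x y : B x e = 0 -> B y e = 0 -> B x y = 0 ->
  mul y x = - mul x y.
Proof.
move=> xe ye xy; have xye : B (x + y) e = 0 by rewrite !formE xe ye addr0.
have := imag_mulK e xye; have := imag_mulK e xe; have := imag_mulK e ye.
rewrite !mul_r_e !(prodE bil) !formE [B y x]BC xy => -> -> h.
apply/eqP; rewrite -addr_eq0 addrC; apply/eqP.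
have -> : mul x y + mul y x = - B x x *: e + mul x y + (mul y x + - B y y *: e)
   + (B x x + B y y) *: e by vring.
by rewrite h; vring.
Qed.

Lemma quaternion_table i j (k := mul i j) :
  B i e = 0 -> B j e = 0 -> B i j = 0 -> B i i = 1 -> B j j = 1 ->
  [/\ mul i i = - e, mul j j = - e, mul k k = - e,
      (mul j i = - k) * (mul j k = i) * (mul k j = - i) *
      (mul k i = j) * (mul i k = - j)
    & (B k e = 0) * (B i k = 0) * (B j k = 0) * (B k k = 1)].
Proof.
move=> ie je ij ii jj.
have ke : B k e = 0.
  have := form_mul_exchange i j e e; rewrite !mul_e !mul_r_e [B i e]ie.
  by rewrite [B i j]ij; lra.
have ik : B i k = 0.
  by rewrite -{1}(mul_r_e i) form_mul_l [B e j]BC je mulr0.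
have jk : B j k = 0.
  by rewrite -{1}(mul_e j) form_mul_r [B e i]BC ie mul0r.
have kk : B k k = 1 by rewrite B_mul ii jj mulr1.
have sq x : B x e = 0 -> B x x = 1 -> mul x x = - e.
  by move=> xe xx; have := imag_mulK e xe; rewrite mul_r_e xx scaleN1r.
have ik_j : mul i k = - j by rewrite imag_mulK // ii scaleN1r.
have kj_i : mul k j = - i by rewrite mul_imagK // jj scaleN1r.
split; [exact: sq|exact: sq|exact: sq| |by rewrite ke ik jk kk].
have ki_j : mul k i = j by rewrite (imag_mulC _ _ ik) // ik_j opprK.
have jk_i : mul j k = i.
  by rewrite -[RHS]opprK -kj_i (imag_mulC ke je) ?opprK // BC.
by rewrite (imag_mulC ie je ij) ik_j kj_i ki_j jk_i.
Qed.

End UnitalQuaternions.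

End Composition.

(** * Right multiplication by the left unit and its eigenbasis *)

Section LeftUnit.
Variables (R : realType) (A : vectType R) (mul : A -> A -> A) (B : A -> A -> R).
Variable e : A.
Hypothesis bil : bilinear_prod mul.
Hypothesis mul_e : forall x, mul e x = x.
Hypothesis BC : forall x y, B x y = B y x.
Hypothesis BDl : forall x y z, B (x + y) z = B x z + B y z.
Hypothesis BZl : forall a x y, B (a *: x) y = a * B x y.
Hypothesis B_gt0 : forall x, x != 0 -> 0 < B x x.
Hypothesis B_mul : forall x y, B (mul x y) (mul x y) = B x x * B y y.
Hypothesis B_e : B e e = 1.

Let form0l := form0l BZl.
Let formE := formE BC BDl BZl.
Let formZr := formZr BC BZl.
Let form_nondeg := form_nondeg B_gt0.
Let form_mul_r := form_mul_r bil BC BDl B_mul.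

Lemma right_e_isometry x y : B (mul x e) (mul y e) = B x y.
Proof. by rewrite form_mul_r B_e mulr1. Qed.

(* The coefficient of t in the associator of s = (e + t u)^2 with itself is
   the associator (v, e, e), where v = u + u e. *)
Lemma right_e_involution u :
  (forall x, associator mul (mul x x) (mul x x) (mul x x) = 0) ->
  mul (mul u e) e = u.
Proof.
move=> assoc0.
pose v := u + mul u e; pose w := mul u u.
have vee : associator mul v e e = 0.
  apply: form_nondeg => z; pose a x1 x2 x3 := B (associator mul x1 x2 x3) z.
  have ae x y : a e x y = 0 by rewrite /a /associator !mul_e subrr form0l.
  have aD1 x y x2 x3 : a (x + y) x2 x3 = a x x2 x3 + a y x2 x3.
    by rewrite /a /associator !(prodE bil) !formE; ring.
  have aD2 x y x1 x3 : a x1 (x + y) x3 = a x1 x x3 + a x1 y x3.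
    by rewrite /a /associator !(prodE bil) !formE; ring.
  have aD3 x y x1 x2 : a x1 x2 (x + y) = a x1 x2 x + a x1 x2 y.
    by rewrite /a /associator !(prodE bil) !formE; ring.
  have aZ1 t x x2 x3 : a (t *: x) x2 x3 = t * a x x2 x3.
    by rewrite /a /associator !(prodE bil) !formE; ring.
  have aZ2 t x x1 x3 : a x1 (t *: x) x3 = t * a x1 x x3.
    by rewrite /a /associator !(prodE bil) !formE; ring.
  have aZ3 t x x1 x2 : a x1 x2 (t *: x) = t * a x1 x2 x.
    by rewrite /a /associator !(prodE bil) !formE; ring.
  apply: (@linear_coef_eq0 _ (a v e e) (a v v e + a v e v + a w e e)
    (a v v v + a v w e + a v e w + a w v e + a w e v)
    (a v v w + a v w v + a w v v + a w w e + a w e w)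
    (a v w w + a w v w + a w w v) (a w w w)) => t.
  have := form0l z; rewrite -(assoc0 (e + t *: u)).
  have -> : mul (e + t *: u) (e + t *: u) = e + t *: v + t ^+ 2 *: w.
    by rewrite /v /w !(prodE bil) !mul_e; vring.
  rewrite -[B _ z]/(a _ _ _) => <-.
  by rewrite !(aD1, aD2, aD3, aZ1, aZ2, aZ3) !ae; ring.
have inj_e x : mul x e = 0 -> x = 0.
  move=> xe; apply: form_nondeg => y.
  by rewrite -right_e_isometry xe form0l.
have fix_e x : associator mul x e e = 0 -> mul x e = x.
  rewrite /associator mul_e => xee; apply/eqP; rewrite -subr_eq0.
  by apply/eqP/inj_e; rewrite !(prodE bil).
(* Now [v e = v] reads [u e + (u e) e = u + u e], and [u e] cancels. *)
move: (fix_e _ vee); rewrite /v (prodDl bil) addrC.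
by move/addIr.
Qed.

(** Says that [e, i, j, k] is orthonormal, the unit length of [e] itself being [B_e]. *)
Definition orthonormal4 i j k :=
  [/\ (B i i = 1) * (B j j = 1) * (B k k = 1),
      (B i e = 0) * (B j e = 0) * (B k e = 0)
    & (B i j = 0) * (B i k = 0) * (B j k = 0)].

(** Orthonormality makes [g] a left inverse of [f]; equality of dimensions makes [f] bijective, so
    [g] is its inverse on both sides. *)
Lemma orthonormal4_coords i j k (f := fun p : quat R =>
    qc p 0 *: e + qc p 1 *: i + qc p 2 *: j + qc p 3 *: k)
  (g := fun x => qmk (B x e) (B x i) (B x j) (B x k)) :
  \dim {:A} = 4%N -> orthonormal4 i j k -> cancel f g /\ cancel g f.
Proof.
move=> dimA [[[ii jj] kk] [[ie je] ke] [[ij ik] jk]].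
have fK : cancel f g.
  move=> p; apply: quatP; rewrite !qcE /f !formE.
  - by rewrite B_e ie je ke; ring.
  - by rewrite [B e i]BC [B j i]BC [B k i]BC ii ie ij ik; ring.
  - by rewrite [B e j]BC [B k j]BC jj je ij jk; ring.
  - by rewrite [B e k]BC kk ke ik jk; ring.
split=> //; have [||| h fh hf] := @linear_inj_bij R (quat R) A f.
- by move=> a p q; rewrite /f !(qcD, qcZ); vring.
- move=> p p0; rewrite -[p]fK p0 /g !form0l.
  by apply: quatP; rewrite !qcE.
- by rewrite dimvf dim_matrix dimA.
by move=> x; rewrite -[x in LHS]hf fK hf.
Qed.

(** For the involution [T x = x e], either [v + T v] is a nonzero fixed vector or [T v = - v]. The
    predicate [P] stands for a [T]-invariant subspace in which the eigenvector is sought. *)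
Lemma right_e_eigenvector (P : A -> Prop) v :
  (forall x, mul (mul x e) e = x) ->
  (forall a x y, P x -> P y -> P (a *: x + y)) ->
  (forall x, P x -> P (mul x e)) -> v != 0 -> P v ->
  exists x c, [/\ c = 1 \/ c = -1, B x x = 1, P x & mul x e = c *: x].
Proof.
move=> invT Plin PT v0 Pv.
have P0 : P 0 by rewrite -(addNr v) -scaleN1r; apply: Plin.
have normalize w c : w != 0 -> P w -> mul w e = c *: w ->
    exists2 x, B x x = 1 & P x /\ mul x e = c *: x.
  move=> w0 Pw we; have Bw := B_gt0 w0.
  exists ((Num.sqrt (B w w))^-1 *: w); last first.
    split; last by rewrite (prodZl bil) we !scalerA mulrC.
    by rewrite -[X in P X]addr0; apply: Plin.
  rewrite !formE mulrA -expr2 exprVn sqr_sqrtr ?ltW // mulVf //.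
  by rewrite lt0r_neq0.
case: (eqVneq (v + mul v e) 0) => [ve|ve]; last first.
  have [||x xx [Px xe]] := normalize (v + mul v e) 1 ve.
  - by have := Plin 1 _ _ Pv (PT _ Pv); rewrite scale1r.
  - by rewrite (prodDl bil) invT scale1r addrC.
  by exists x, 1; split=> //; left.
have [|x xx [Px xe]] := normalize v (-1) v0 Pv.
- by rewrite scaleN1r; apply/eqP; rewrite -addr_eq0 addrC ve.
by exists x, (-1); split=> //; right.
Qed.

(* Orthonormal i and j are chosen among the eigenvectors of v |-> v e on e^perp;
   k = (i e) j is then an eigenvector too. *)
Lemma eigen_quaternion_basis : \dim {:A} = 4%N ->
  (forall x, mul (mul x e) e = x) ->
  exists i j k a b c, [/\ orthonormal4 i j k,
    [/\ a = 1 \/ a = -1, b = 1 \/ b = -1 & c = 1 \/ c = -1],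
    [/\ mul i e = a *: i, mul j e = b *: j & mul k e = c *: k],
    [/\ mul i i = - a *: e, mul j j = - b *: e & mul k k = - c *: e]
  & [/\ mul i j = a *: k, mul j i = - b *: k,
       mul j k = b *: i, mul k j = - c *: i
     & mul k i = c *: j /\ mul i k = - a *: j]].
Proof.
move=> dimA invT.
have ker3 (s : 'I_3 -> A) : exists2 x, x != 0 & forall l, B x (s l) = 0.
  have [||x x0 sx] := @linear_nontrivial_ker R A 'rV[R]_3
    (fun x => \row_l B x (s l)).
  - by move=> c x y; apply/rowP => l; rewrite !mxE !formE.
  - by rewrite dimvf dim_matrix dimA.
  by exists x => // l; have /rowP/(_ l) := sx; rewrite !mxE.
(* An involutive isometry is self-adjoint, so orthogonal complements of eigenvectors are
   invariant. *)
have TB x y : B (mul x e) y = B x (mul y e).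
  by rewrite -[y in LHS]invT right_e_isometry.
have [v v0 vs] := ker3 (fun=> e).
have [||i [a [a1 ii ie ia]]] := @right_e_eigenvector (fun x => B x e = 0) v
  invT _ _ v0 (vs ord0).
- by move=> c x y xe ye; rewrite !formE xe ye mulr0 addr0.
- by move=> x xe; rewrite TB mul_e.
(* The third entry is the default value [0], which imposes no condition. *)
have [w w0 ws] := ker3 (fun l => [:: e; i]`_l).
have [|||j [b [b1 jj [je ji] jb]]] := @right_e_eigenvector
  (fun x => B x e = 0 /\ B x i = 0) w invT _ _ w0.
- by move=> c x y [xe xi] [ye yi]; rewrite !formE xe ye xi yi mulr0 addr0.
- by move=> x [xe xi]; rewrite !TB mul_e ia formZr xe xi mulr0.
- by split; [exact: (ws ord0) | exact: (ws (@Ordinal 3 1 isT))].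
have aa : a * a = 1 by case: a1 => ->; ring.
have bb : b * b = 1 by case: b1 => ->; ring.
(* Twisting by [T] makes [e] a two-sided unit and keeps the form multiplicative. *)
pose op x y := mul (mul x e) y.
have op_bil : bilinear_prod op.
  by split=> c x y z; rewrite /op !(prodE bil).
have op_e x : op e x = x by rewrite /op !mul_e.
have op_r_e x : op x e = x by rewrite /op invT.
have op_mul x y : B (op x y) (op x y) = B x x * B y y.
  by rewrite /op B_mul right_e_isometry.
have ij : B i j = 0 by rewrite BC.
have := @quaternion_table _ _ op _ _ op_bil op_e BC BDl BZl B_gt0 op_mul op_r_e _ _ ie je ij ii jj.
set k := op i j => -[iiE jjE kkE tab [[[ke ik] jk] kk]].
have ijk : orthonormal4 i j k by split.
have [fK gK] := orthonormal4_coords dimA ijk.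
pose c := B (mul k e) k.
(* By self-adjointness [T k] is orthogonal to [e], [i] and [j], so only its [k] coordinate
   remains. *)
have kc : mul k e = c *: k.
  rewrite -[LHS]gK !qcE TB mul_e ke [B _ i]TB ia formZr [B k i]BC ik.
  rewrite [B _ j]TB jb formZr [B k j]BC jk -/c.
  by rewrite !mulr0 !scale0r !add0r.
have c1 : c = 1 \/ c = -1.
  have : c ^+ 2 == 1.
    have := right_e_isometry k k; rewrite kc !formE kk => cc.
    by apply/eqP; rewrite -cc; ring.
  by rewrite sqrf_eq1 => /orP [] /eqP; [left|right].
have cc : c * c = 1 by case: c1 => ->; ring.
(* On an eigenvector [x] with sign [s], the two products differ by the factor [s], so the table of
   [mul] is the quaternion table with signs. *)
have mulE x y s : mul x e = s *: x -> s * s = 1 -> mul x y = s *: op x y.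
  by move=> xs ss; rewrite /op xs (prodZl bil) scalerA ss scale1r.
exists i, j, k, a, b, c; split=> //.
- by rewrite !(mulE _ _ _ ia aa, mulE _ _ _ jb bb, mulE _ _ _ kc cc) iiE jjE kkE !scalerN !scaleNr.
by rewrite !(mulE _ _ _ ia aa, mulE _ _ _ jb bb, mulE _ _ _ kc cc) !tab
   !scalerN !scaleNr.
Qed.

End LeftUnit.

Lemma alg_isomorphic_trans (R : realType) (U V W : vectType R)
    (mU : U -> U -> U) (mV : V -> V -> V) (mW : W -> W -> W) :
  alg_isomorphic mU mV -> alg_isomorphic mV mW -> alg_isomorphic mU mW.
Proof.
move=> [f [flin [fbij fmul]]] [g [glin [gbij gmul]]].
exists (g \o f); split=> [a x y|]; first by rewrite /= flin glin.
by split=> [|x y]; [exact: bij_comp | rewrite /= fmul gmul].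
Qed.

Lemma alg_isomorphic_assoc (R : realType) (V W : vectType R)
    (mV : V -> V -> V) (mW : W -> W -> W) :
  alg_isomorphic mV mW ->
  (forall x, associator mV (mV x x) (mV x x) (mV x x) = 0) ->
  forall y, associator mW (mW y y) (mW y y) (mW y y) = 0.
Proof.
move=> [f [flin [[g fK gK] fmul]]] assoc0 y; rewrite -[y]gK.
have := congr1 f (assoc0 (g y)).
rewrite /associator -!fmul.
have fB u v : f (u - v) = f u - f v.
  by rewrite -scaleN1r addrC flin scaleN1r addrC.
by rewrite fB => ->; rewrite -[0](subrr (0 : V)) fB subrr.
Qed.

(** * Quaternion products twisted by a diagonal matrix of signs *)

Section SignedQuaternions.
Variable R : realType.

Definition qsign_mul (a b c : R) (p q : quat R) :=
  qmul (qmk (qc p 0) (a * qc p 1) (b * qc p 2) (c * qc p 3)) q.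

Lemma qsign_mul_qmul : alg_isomorphic (qsign_mul 1 1 1) (@qmul R).
Proof.
exists id; split=> //; split; first by exists id.
by move=> p q; apply: quatP; rewrite !qcE; ring.
Qed.

Lemma qsign_mul_qstar : alg_isomorphic (qsign_mul (-1) (-1) (-1)) (@qstar_mul R).
Proof.
exists id; split=> //; split; first by exists id.
by move=> p q; apply: quatP; rewrite !qcE; ring.
Qed.

(* The signs (-, +, +) give the product i (conj p) (-i) q. *)
Lemma qsign_mul_qstar_i1 : alg_isomorphic (qsign_mul (-1) 1 1) (@qstar_i1_mul R).
Proof.
(* The isomorphism is [p -> i p], since [i (i (conj p) (-i)) q = (conj p) i q = conj (i p) i (i
   q)]. *)
exists (qmul (qi R)); split; first by move=> a p q; apply: quatP; rewrite !qcE; ring.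
split; last by move=> p q; apply: quatP; rewrite !qcE; ring.
by exists (qmul (- qi R)) => p; apply: quatP; rewrite !qcE; ring.
Qed.

(** The cyclic permutation of [i, j, k] is an automorphism of the quaternions. *)
Lemma qsign_mul_rot (a b c : R) :
  alg_isomorphic (qsign_mul a b c) (qsign_mul b c a).
Proof.
exists (fun p => qmk (qc p 0) (qc p 2) (qc p 3) (qc p 1)); split.
  by move=> s p q; apply: quatP; rewrite !qcE; ring.
split; last by move=> p q; apply: quatP; rewrite !qcE; ring.
by exists (fun p => qmk (qc p 0) (qc p 3) (qc p 1) (qc p 2)) => p;
  apply: quatP; rewrite !qcE.
Qed.

Lemma qsign_mul_assoc_neq0 :
  ~ (forall p, associator (qsign_mul 1 (-1) (-1)) (qsign_mul 1 (-1) (-1) p p)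
      (qsign_mul 1 (-1) (-1) p p) (qsign_mul 1 (-1) (-1) p p) = 0).
Proof.
(* The square of [i + j] is [s = 2k]. Then [s s = 4], so [(s s) s = 8k] while [s (s s) = - 8k], and
   the [k] coordinate of the associator is 16. *)
move=> /(_ (qmk 0 1 1 0)) /(congr1 (fun q : quat R => qc q 3)).
have -> : qsign_mul 1 (-1) (-1) (qmk 0 1 1 0) (qmk 0 1 1 0) = qmk 0 0 0 2.
  by apply: quatP; rewrite !qcE; ring.
by rewrite /associator !qcE; lra.
Qed.

Lemma qsign_mul_classification (a b c : R) :
  a = 1 \/ a = -1 -> b = 1 \/ b = -1 -> c = 1 \/ c = -1 ->
  (forall p, associator (qsign_mul a b c) (qsign_mul a b c p p)
      (qsign_mul a b c p p) (qsign_mul a b c p p) = 0) ->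
  alg_isomorphic (qsign_mul a b c) (@qmul R) \/
  alg_isomorphic (qsign_mul a b c) (@qstar_mul R) \/
  alg_isomorphic (qsign_mul a b c) (@qstar_i1_mul R).
Proof.
move=> a1 b1 c1; have rot := qsign_mul_rot.
have rot2 x y z := alg_isomorphic_trans (rot x y z) (rot y z x).
have two_minus x y z : alg_isomorphic (qsign_mul x y z) (qsign_mul 1 (-1) (-1)) ->
    ~ (forall p, associator (qsign_mul x y z) (qsign_mul x y z p p)
        (qsign_mul x y z p p) (qsign_mul x y z p p) = 0).
  by move=> iso /(alg_isomorphic_assoc iso) /qsign_mul_assoc_neq0.
(* Cyclic shifts bring a single minus sign, or the single plus sign among two minus signs, to the
   first place. *)
case: a1 b1 c1 => -> [] -> [] -> assoc0.
- by left; exact: qsign_mul_qmul.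
- by right; right; apply: alg_isomorphic_trans (rot2 _ _ _) qsign_mul_qstar_i1.
- by right; right; apply: alg_isomorphic_trans (rot _ _ _) qsign_mul_qstar_i1.
- by case: qsign_mul_assoc_neq0.
- by right; right; exact: qsign_mul_qstar_i1.
- by case: (two_minus _ _ _ (rot _ _ _)).
- by case: (two_minus _ _ _ (rot2 _ _ _)).
by right; left; exact: qsign_mul_qstar.
Qed.

End SignedQuaternions.

(** * From the absolute-valued algebra to signed quaternions *)

Section Classification.
Variables (R : realType) (A : vectType R) (mul : A -> A -> A) (N : A -> R).
Hypothesis dimA : \dim {:A} = 4%N.
Hypothesis avA : absolute_valued mul N.

Lemma av_qsign_mul e : (forall x, mul e x = x) ->
  (forall x : A, associator mul (mul x x) (mul x x) (mul x x) = 0) ->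
  exists a b c, [/\ a = 1 \/ a = -1, b = 1 \/ b = -1 & c = 1 \/ c = -1] /\
    alg_isomorphic mul (qsign_mul a b c : quat R -> quat R -> quat R).
Proof.
move=> mul_e assoc0; case: avA => A0 [bil [normN norm_mul]].
have BC := dotC normN.
have BDl := dotDl A0 bil normN norm_mul mul_e.
have BZl := dotZl A0 bil normN norm_mul mul_e.
have B_self := dot_self normN.
have B_gt0 x : x != 0 -> 0 < dot N x x.
  by move=> x0; rewrite B_self exprn_gt0 // norm_gt0.
have B_mul x y : dot N (mul x y) (mul x y) = dot N x x * dot N y y.
  by rewrite !B_self norm_mul exprMn.
have B_e : dot N e e = 1.
  by rewrite B_self (norm_e A0 bil normN norm_mul mul_e) expr1n.
have invT := right_e_involution bil mul_e BC BDl BZl B_gt0 B_mul B_e ^~ assoc0.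
have [i [j [k [a [b [c]]]]]] :=
  eigen_quaternion_basis bil mul_e BC BDl BZl B_gt0 B_mul B_e dimA invT.
case=> ijk abc [ie je ke] [ii jj kk] [ij ji jk kj [ki ik]].
exists a, b, c; split=> //.
have [fK gK] := orthonormal4_coords BC BDl BZl B_e dimA ijk.
set f := (fun p : quat R => _) in fK gK; set g := (fun x : A => _) in fK gK.
exists g; split.
  by move=> s x y; apply: quatP; rewrite /g !qcE BDl BZl.
split=> [|x y]; first by exists f.
(* It remains to see that [f] is multiplicative, which by bilinearity is the multiplication table of
   the eigenbasis. *)
rewrite -{1}[x]gK -{1}[y]gK -[RHS]fK; congr g.
move: (g x) (g y) => p q; rewrite /f !qcE !(prodE bil) !mul_e.
rewrite ie je ke ii jj kk ij ji jk kj ki ik.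
by vring.
Qed.

End Classification.

Theorem theorem4 (R : realType) (A : vectType R) (mul : A -> A -> A) (nrm : A -> R) :
  \dim (fullv : {vspace A}) = 4%N ->
  absolute_valued mul nrm ->
  has_left_unit mul ->
  (forall x : A, associator mul (mul x x) (mul x x) (mul x x) = 0) ->
  (alg_isomorphic mul (@qmul R) \/ alg_isomorphic mul (@qstar_mul R) \/
   alg_isomorphic mul (@qstar_i1_mul R)) /\
  algebra_degree (@qstar_i1_mul R) 4 /\
  algebra_degree (@qmul R) 2 /\
  algebra_degree (@qstar_mul R) 2.
Proof.
move=> dimA avA [e mul_e] assoc0; split; last first.
  by split; [exact: degree_qstar_i1_mul | split;
    [exact: degree_qmul | exact: degree_qstar_mul]].
have [a [b [c [[a1 b1 c1] iso]]]] := av_qsign_mul dimA avA mul_e assoc0.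
have [iso'|[iso'|iso']] :=
    qsign_mul_classification a1 b1 c1 (alg_isomorphic_assoc iso assoc0).
- by left; apply: alg_isomorphic_trans iso iso'.
- by right; left; apply: alg_isomorphic_trans iso iso'.
by right; right; apply: alg_isomorphic_trans iso iso'.
Qed.
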